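(* If the submatrix $B_{\bar H|H}$ of the pre-attack admittance matrix $B$ (rows indexed by $V\setminus V_H$, columns indexed by $V_H$) has full column rank, then the post-attack phase angles $\theta'_H=(\theta'_v)_{v\in V_H}$ within the attacked area can be recovered correctly; that is, $\theta'_H$ is uniquely determined by the data available to the control center, namely $B$, the pre-attack state $\theta,p$, and the post-attack measurements $\theta'_{\bar H}=(\theta'_v)_{v\in V\setminus V_H}$ and $\Delta_{\bar H}=(\Delta_v)_{v\in V\setminus V_H}$ from the unattacked area. The post-attack grid $(V,E\setminus F)$ is not assumed to be connected, and $\Delta$ is not assumed to be zero.
   Context: Let $G=(V,E)$ be a finite connected simple undirected graph (the power grid); each link $(s,t)\in E$ has a reactance $r_{st}=r_{ts}\neq 0$. The admittance matrix $B=(b_{uv})_{u,v\in V}$ of $G$ is the real matrix with $b_{uv}=-1/r_{uv}$ if $u\ne v$ and $(u,v)\in E$, $b_{uv}=0$ if $u\neq v$ and $(u,v)\notin E$, and $b_{uu}=-\sum_{w\in V\setminus\{u\}}b_{uw}$. Before the attack, the phase angles $\theta\in\mathbb R^V$ and active power injections $p\in\mathbb R^V$ satisfy $B\theta=p$. The attacked area $H=(V_H,E_H)$ is the subgraph of $G$ induced by a node set $V_H\subseteq V$; $\bar H$ denotes the unattacked area, with node set $V\setminus V_H$. The attack disconnects a nonempty set $F\subseteq E_H$ of links (unknown to the control center) and blocks measurements from $V_H$. After the attack, the phase angles $\theta'$ and injections $p'$ satisfy $B'\theta'=p'$, where $B'$ is the admittance matrix of $(V,E\setminus F)$ with the same reactances.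 Put $\Delta:=p-p'$. *)

(* Defs.v *)
From HB Require Import structures.
From mathcomp Require Import all_boot all_order all_algebra.
From mathcomp Require Import reals.
Set Implicit Arguments.
Unset Strict Implicit.
Unset Printing Implicit Defensive.
Import GRing.Theory.
Local Open Scope ring_scope.

(* A link is an unordered pair {s, t}, so a grid on the node type V is a set
   E of subsets of V; [simple_graph] excludes anything but 2-element sets
   (in particular loops, since [set u; u] is a singleton). *)
Definition simple_graph (V : finType) (E : {set {set V}}) : Prop :=
  forall l : {set V}, l \in E -> #|l| = 2.

Definition adj (V : finType) (E : {set {set V}}) : rel V :=
  fun u v => [set u; v] \in E.

Definition connected_graph (V : finType) (E : {set {set V}}) : Prop :=
  forall u v : V, connect (adj E) u v.

(* E_H, for H the subgraph induced by VH. *)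
Definition induced_links (V : finType) (E : {set {set V}}) (VH : {set V}) :
    {set {set V}} :=
  [set l in E | l \subset VH].

Section Admittance.
Variables (R : realType) (V : finType).
Implicit Types (E : {set {set V}}) (r : V -> V -> R) (A C : {set V}).

(* The values of r outside the links of E are irrelevant. *)
Definition offdiag_admittance E r (u v : V) : R :=
  if adj E u v then - (1 / r u v) else 0.

Definition admittance_entry E r (u v : V) : R :=
  if u == v then - \sum_(w | w != u) offdiag_admittance E r u w
  else offdiag_admittance E r u v.

(* Vectors and matrices indexed by V are indexed by 'I_#|V|, through the
   bijections enum_val / enum_rank between 'I_#|V| and V. *)
Definition admittance E r : 'M[R]_#|V| :=
  \matrix_(i, j) admittance_entry E r (enum_val i) (enum_val j).

(* The inclusion of A in V, on indices. *)
Definition incl A (i : 'I_#|A|) : 'I_#|V| := enum_rank (enum_val i).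

(* M_{A|C}: rows in A, columns in C. *)
Definition submatrix A C (M : 'M[R]_#|V|) : 'M[R]_(#|A|, #|C|) :=
  mxsub (@incl A) (@incl C) M.

Definition subvector A (x : 'cV[R]_#|V|) : 'cV[R]_#|A| :=
  rowsub (@incl A) x.

End Admittance.

Definition full_column_rank (R : realType) (m n : nat) (M : 'M[R]_(m, n)) :
    Prop :=
  \rank M = n.

(* Main.v *)
Require Import Defs.
From HB Require Import structures.
From mathcomp Require Import all_boot all_order all_algebra.
From mathcomp Require Import reals.
Set Implicit Arguments.
Unset Strict Implicit.
Unset Printing Implicit Defensive.
Import GRing.Theory.
Local Open Scope ring_scope.

(** A link with an end outside [VH] survives the attack, so [B'] and [B] have
the same rows outside [VH]. There, [B' theta' = p'] reads
[B_{~H|H} theta'_H = p_{~H} - Delta_{~H} - B_{~H|~H} theta'_{~H}], and a left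
inverse of [B_{~H|H}] recovers [theta'_H]. *)

Lemma adj_remove_induced (V : finType) (E F : {set {set V}}) (VH : {set V})
    (u v : V) :
  F \subset induced_links E VH -> u \notin VH -> adj (E :\: F) u v = adj E u v.
Proof.
move=> /subsetP sFE uNVH; rewrite /adj inE andbC.
(* A removed link is contained in [VH], so it cannot have [u] as an end. *)
case uvE: (_ \in E) => //=; apply/negP => /sFE.
by rewrite inE uvE subUset sub1set (negPf uNVH).
Qed.

(** The diagonal entry is unchanged too, because it sums only over links at [u], all of which
    survive. *)
Lemma admittance_entry_remove_induced (R : realType) (V : finType)
    (E F : {set {set V}}) (r : V -> V -> R) (VH : {set V}) (u v : V) :
  F \subset induced_links E VH -> u \notin VH ->
  admittance_entry (E :\: F) r u v = admittance_entry E r u v.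
Proof.
move=> sFE uNVH.
have offE w : offdiag_admittance (E :\: F) r u w = offdiag_admittance E r u w.
  by rewrite /offdiag_admittance (adj_remove_induced w sFE uNVH).
by rewrite /admittance_entry offE; under eq_bigr do rewrite offE.
Qed.

Lemma submatrix_admittance_remove_induced (R : realType) (V : finType)
    (E F : {set {set V}}) (r : V -> V -> R) (VH C : {set V}) :
  F \subset induced_links E VH ->
  submatrix (~: VH) C (admittance (E :\: F) r)
  = submatrix (~: VH) C (admittance E r).
Proof.
move=> sFE; apply/matrixP => i j; rewrite !mxE.
apply: (admittance_entry_remove_induced _ _ sFE).
by rewrite enum_rankK -in_setC enum_valP.
Qed.

Lemma subvector_mulmx (R : realType) (V : finType) (A C : {set V})
    (M : 'M[R]_#|V|) (x : 'cV[R]_#|V|) :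
  subvector A (M *m x)
  = submatrix A C M *m subvector C x
    + submatrix A (~: C) M *m subvector (~: C) x.
Proof.
apply/matrixP => i k; rewrite !mxE.
(* Summing over nodes instead of indices lets the sum split by membership in [C]; [big_enum_val]
   then renumbers each part as [incl] does. *)
rewrite (reindex (@enum_rank V)) /=; last exact: onW_bij (@enum_rank_bij V).
rewrite (bigID (mem C)) /=; congr (_ + _).
  by rewrite big_enum_val; apply: eq_bigr => j _; rewrite !mxE.
under eq_bigl do rewrite -in_setC.
by rewrite big_enum_val; apply: eq_bigr => j _; rewrite !mxE.
Qed.

Theorem mainTheorem1 (R : realType) (V : finType) (VH : {set V}) :
  exists recover : 'M[R]_#|V| -> 'cV[R]_#|V| -> 'cV[R]_#|V| ->
                   'cV[R]_#|~: VH| -> 'cV[R]_#|~: VH| -> 'cV[R]_#|VH|,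
  forall (E F : {set {set V}}) (r : V -> V -> R)
         (theta p theta' p' : 'cV[R]_#|V|),
    simple_graph E ->
    connected_graph E ->
    (forall s t : V, [set s; t] \in E -> r s t = r t s /\ r s t != 0) ->
    F != set0 ->
    F \subset induced_links E VH ->
    admittance E r *m theta = p ->
    admittance (E :\: F) r *m theta' = p' ->
    full_column_rank (submatrix (~: VH) VH (admittance E r)) ->
    recover (admittance E r) theta p
            (subvector (~: VH) theta') (subvector (~: VH) (p - p'))
    = subvector VH theta'.
Proof.
(* Here [x] stands for [theta'_{~H}] and [d] for [Delta_{~H}]. The pseudoinverse makes the formula
   total in [B]; it is a left inverse when the rank condition holds. *)
exists (fun B _ p x d => pinvmx (submatrix (~: VH) VH B) *m
  (subvector (~: VH) p - d - submatrix (~: VH) (~: VH) B *m x)).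
move=> E F r theta p theta' p' _ _ _ _ sFE _ <- rankB.
set A := submatrix (~: VH) VH _ in rankB *.
(* Subtracting [Delta_{~H}] from [p_{~H}] leaves the post-attack injections [p'_{~H}]. *)
have -> : subvector (~: VH) p
          - subvector (~: VH) (p - admittance (E :\: F) r *m theta')
          = subvector (~: VH) (admittance (E :\: F) r *m theta').
  by rewrite /subvector linearB /= opprB addrC subrK.
rewrite (subvector_mulmx _ VH) !submatrix_admittance_remove_induced // addrK.
(* Despite its name, [row_full] says that the rank equals the number of columns, which is full
   column rank. *)
by rewrite mulmxA mulVpmx ?mul1mx // /row_full rankB.
Qed.
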